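(* Let $\mathcal F=\{f_i\}_{i\in I}$ be a $J$-frame for a Krein space $(\mathcal H,[\cdot,\cdot])$ with $J$-frame operator $S$, let $\mathcal M_\pm=\overline{\operatorname{span}\{f_i: i\in I_\pm\}}$, and let $0<\alpha_\pm\le\beta_\pm$ be the $J$-frame bounds of $\mathcal F$. If, with respect to the fundamental decomposition $\mathcal H=\mathcal M_-^{[\perp]}\,[\dotplus]\,\mathcal M_-$, $S$ is represented as $$S=\begin{bmatrix} A & -AK\\ K^*A & D\end{bmatrix}$$ with $A$ uniformly positive in $(\mathcal M_-^{[\perp]},[\cdot,\cdot])$, $K:\mathcal M_-\to\mathcal M_-^{[\perp]}$, $\|K\|<1$, and $D$ self-adjoint with $D+K^*AK$ uniformly positive in $(\mathcal M_-,-[\cdot,\cdot])$, then $$\alpha_-=\inf W(D+K^*AK)\quad\text{and}\quad\beta_-=\sup W(D+K^*AK).$$ If, with respect to the fundamental decomposition $\mathcal H=\mathcal M_+\,[\dotplus]\,\mathcal M_+^{[\perp]}$, $S$ is represented as $$S=\begin{bmatrix} A' & LD'\\ -D'L^* & D'\end{bmatrix}$$ with $A'$ self-adjoint and $A'+LD'L^*$ uniformly positive in $(\mathcal M_+,[\cdot,\cdot])$, $L:\mathcal M_+^{[\perp]}\to\mathcal M_+$, $\|L\|<1$, and $D'$ uniformly positive in $(\mathcal M_+^{[\perp]},-[\cdot,\cdot])$, then $$\alpha_+=\inf W(A'+LD'L^* )\quad\text{and}\quad\beta_+=\sup W(A'+LD'L^* ).$$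
   Context: Krein spaces (over $\mathbb C$). A Krein space $(\mathcal H,[\cdot,\cdot])$ is a vector space with a Hermitian sesquilinear form admitting a fundamental decomposition $\mathcal H=\mathcal H_+\,[\dotplus]\,\mathcal H_-$, i.e. a direct, $[\cdot,\cdot]$-orthogonal sum such that $(\mathcal H_+,[\cdot,\cdot])$ and $(\mathcal H_-,-[\cdot,\cdot])$ are Hilbert spaces. The associated Hilbert inner product is $\langle x_++x_-,y_++y_-\rangle=[x_+,y_+]-[x_-,y_-]$; the norms coming from different fundamental decompositions are equivalent, so the topology of $\mathcal H$ is independent of the choice. $\mathcal M^{[\perp]}=\{x:[x,m]=0\ \forall m\in\mathcal M\}$. A subspace $\mathcal L$ is uniformly positive (negative) if there is $\alpha>0$ with $[x,x]\ge\alpha\|x\|^2$ (resp. $-[x,x]\ge\alpha\|x\|^2$) for all $x\in\mathcal L$; maximal means maximal with respect to inclusion among such subspaces. $J$-frames. A family $\mathcal F=\{f_i\}_{i\in I}$ in $\mathcal H$ is a Bessel family if $\sum_{i\in I}|\langle f,f_i\rangle|^2\le\beta\|f\|^2$ for all $f$, for some $\beta<\infty$. Its synthesis operator is the bounded operator $T:\ell_2(I)\to\mathcal H$, $Tx=\sum_{i\in I}x_if_i$. Put $I_+=\{i:[f_i,f_i]\ge0\}$, $I_-=\{i:[f_i,f_i]<0\}$, and $T_\pm x=\sum_{i\in I_\pm}x_if_i$. $\mathcal F$ is a $J$-frame for $\mathcal H$ if the range $R(T_+)$ is a maximal uniformly positive subspace and $R(T_-)$ is a maximal uniformly negative subspace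 of $\mathcal H$; then $R(T_\pm)=\mathcal M_\pm$, and $\mathcal H=\mathcal M_-^{[\perp]}\,[\dotplus]\,\mathcal M_-$ and $\mathcal H=\mathcal M_+\,[\dotplus]\,\mathcal M_+^{[\perp]}$ are fundamental decompositions. The $J$-frame operator of $\mathcal F$ is $Sf=\sum_{i\in I_+}[f,f_i]f_i-\sum_{i\in I_-}[f,f_i]f_i$. $J$-frame bounds. The $J$-frame bounds of $\mathcal F$ are the optimal constants (largest $\alpha_\pm$, smallest $\beta_\pm$) in $$\alpha_\pm(\pm[f,f])\le\sum_{i\in I_\pm}|[f,f_i]|^2\le\beta_\pm(\pm[f,f])\quad\text{for every }f\in\mathcal M_\pm.$$ Operators. Block operator matrices act on $x_++x_-$ as column vectors and have bounded entries. Adjoints $K^*,L^*$, norms, self-adjointness of entries, and numerical ranges $W(\cdot)$ (the set of values $\langle Bg,g\rangle$, $\|g\|=1$) are taken with respect to the Hilbert spaces formed by the positive component with $[\cdot,\cdot]$ and the negative component with $-[\cdot,\cdot]$. A bounded self-adjoint operator in a Hilbert space is uniformly positive if it is positive-definite and boundedly invertible. *)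

(* Defs.v *)
From mathcomp Require Import all_boot all_order all_algebra.
From mathcomp Require Import finmap.
From mathcomp Require Import all_classical all_reals all_analysis.
From mathcomp Require Import summability complex.

Set Implicit Arguments.
Unset Strict Implicit.
Unset Printing Implicit Defensive.

Import Order.TTheory GRing.Theory Num.Theory.
Import numFieldNormedType.Exports.

Local Open Scope classical_set_scope.
Local Open Scope ring_scope.

Section Hilbert.
Context {R : realType} {V : lmodType R[i]}.

(* A sesquilinear form [V -> V -> R[i]] is passed around as a bare function:
   a Hilbert space is a pair of a linear subspace of V and a form that is an
   inner product on it. Only [krein_form] below bundles the algebraic axioms. *)
Implicit Types (ip ipM ipN q : V -> V -> R[i]) (M N : set V) (B : V -> V).

Definition krein_form := {hermitian V for false & (Num.conj : R[i] -> R[i])}.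

Definition subspace M :=
  M 0 /\ forall (a : R[i]) x y, M x -> M y -> M (a *: x + y).

(* For a Hermitian form q, [q x x] is real. *)
Definition qform q (x : V) : R := complex.Re (q x x).

Definition oppform q : V -> V -> R[i] := fun x y => - q x y.

Definition hnorm ip (x : V) : R := Num.sqrt (qform ip x).

Definition sqmod (z : R[i]) : R := complex.Re `|z| ^+ 2.

Definition hilbert M ip :=
  [/\ subspace M,
      forall x, M x -> x != 0 -> 0 < qform ip x &
      forall u : nat -> V, (forall n, M (u n)) ->
        (forall e : R, 0 < e -> exists N0 : nat, forall m n : nat,
           (N0 <= m)%N -> (N0 <= n)%N -> hnorm ip (u m - u n) < e) ->
        exists2 x, M x & (fun n => hnorm ip (u n - x)) @ \oo --> (0 : R)].

Definition hclosure ip M : set V :=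
  [set x | forall e : R, 0 < e -> exists2 y, M y & hnorm ip (x - y) < e].

Definition linear_span (G : set V) : set V := smallest subspace G.

(* Unconditional convergence, along the net of finite subsets of the index
   set, of the sum of the [g i] with [i] in [J]. *)
Definition has_sum ip {I : choiceType} (J : set I) (g : I -> V) (x : V) :=
  (fun A : {fset I} => hnorm ip (x - \sum_(i <- A | i \in J) g i)) @ totally
    --> (0 : R).

(* An operator from M to N is a function on V whose values outside M are
   irrelevant. *)
Definition bounded_operator M ipM N ipN B :=
  [/\ forall x, M x -> N (B x),
      forall (a : R[i]) x y, M x -> M y -> B (a *: x + y) = a *: B x + B y &
      exists k : R, forall x, M x -> hnorm ipN (B x) <= k * hnorm ipM x].

Definition opnorm M ipM ipN B : \bar R :=
  ereal_sup [set (hnorm ipN (B x))%:E | x in [set x | M x /\ hnorm ipM x <= 1]].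

Definition is_adjoint M ipM N ipN (K Ks : V -> V) :=
  (forall y, N y -> M (Ks y)) /\
  forall x y, M x -> N y -> ipN (K x) y = ipM x (Ks y).

Definition selfadjoint M ip B :=
  bounded_operator M ip M ip B /\
  forall x y, M x -> M y -> ip (B x) y = ip x (B y).

Definition boundedly_invertible M ip B :=
  exists2 B', bounded_operator M ip M ip B' &
    forall x, M x -> B (B' x) = x /\ B' (B x) = x.

Definition uniformly_positive_operator M ip B :=
  [/\ selfadjoint M ip B,
      forall x, M x -> x != 0 -> 0 < complex.Re (ip (B x) x) &
      boundedly_invertible M ip B].

Definition numerical_range M ip B : set R[i] :=
  [set ip (B g) g | g in [set g | M g /\ hnorm ip g = 1]].

(* Used for self-adjoint operators, whose numerical range is real; the extended
   reals avoid the default values of inf and sup on the reals. *)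
Definition inf_range M ip B : \bar R :=
  ereal_inf [set (complex.Re z)%:E | z in numerical_range M ip B].
Definition sup_range M ip B : \bar R :=
  ereal_sup [set (complex.Re z)%:E | z in numerical_range M ip B].

End Hilbert.

Section Krein.
Context {R : realType} {V : lmodType R[i]}.
Implicit Types (h : krein_form (V := V)) (ip q : V -> V -> R[i]).
Implicit Types (M Hp Hm : set V).

(* A Krein space is a space V with a form h for which this holds for some
   Hp and Hm. *)
Definition fundamental_decomposition h Hp Hm :=
  [/\ hilbert Hp h, hilbert Hm (oppform h),
      forall x y, Hp x -> Hm y -> h x y = 0,
      forall x, exists y z, [/\ Hp y, Hm z & x = y + z] &
      forall x, Hp x -> Hm x -> x = 0].

Definition pos_part Hp Hm (x : V) : V := xget 0 [set y | Hp y /\ Hm (x - y)].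

Definition neg_part Hp Hm (x : V) : V := x - pos_part Hp Hm x.

(* The Hilbert inner product associated with a fundamental decomposition. *)
Definition hip h Hp Hm : V -> V -> R[i] := fun x y =>
  h (pos_part Hp Hm x) (pos_part Hp Hm y) -
  h (neg_part Hp Hm x) (neg_part Hp Hm y).

Definition orthocompl h M : set V := [set x | forall m, M m -> h x m = 0].

(* Here and below, q is the form or its opposite, so that both signs are
   covered, and ip is the Hilbert inner product of the space. *)
Definition uniformly_positive_subspace ip q M :=
  subspace M /\
  exists2 a : R, 0 < a & forall x, M x -> a * hnorm ip x ^+ 2 <= qform q x.

Definition maximal_uniformly_positive ip q M :=
  uniformly_positive_subspace ip q M /\
  forall M', uniformly_positive_subspace ip q M' -> M `<=` M' -> M' = M.

Section Frames.
Context {I : choiceType}.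
Implicit Types (F : I -> V) (J : set I).

Definition bessel ip F := exists b : R, forall f,
  (\esum_(i in [set: I]) (sqmod (ip f (F i)))%:E <= (b * hnorm ip f ^+ 2)%:E)%E.

Definition ell2 (c : I -> R[i]) :=
  (\esum_(i in [set: I]) (sqmod (c i))%:E < +oo)%E.

Definition Iplus h F : set I := [set i | 0 <= qform h (F i)].
Definition Iminus h F : set I := [set i | qform h (F i) < 0].

(* The range of x |-> sum of the x_i f_i with i in J, on ell_2(I). *)
Definition synthesis_range ip F J : set V :=
  [set v | exists2 c, ell2 c & has_sum ip J (fun i => c i *: F i) v].

Definition jframe h Hp Hm F :=
  [/\ bessel (hip h Hp Hm) F,
      maximal_uniformly_positive (hip h Hp Hm) h
        (synthesis_range (hip h Hp Hm) F (Iplus h F)) &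
      maximal_uniformly_positive (hip h Hp Hm) (oppform h)
        (synthesis_range (hip h Hp Hm) F (Iminus h F))].

Definition jframe_operator h Hp Hm F (S : V -> V) := forall f,
  exists u v,
    [/\ has_sum (hip h Hp Hm) (Iplus h F) (fun i => h f (F i) *: F i) u,
        has_sum (hip h Hp Hm) (Iminus h F) (fun i => h f (F i) *: F i) v &
        S f = u - v].

Definition Mplus h Hp Hm F : set V :=
  hclosure (hip h Hp Hm) (linear_span (F @` Iplus h F)).
Definition Mminus h Hp Hm F : set V :=
  hclosure (hip h Hp Hm) (linear_span (F @` Iminus h F)).

Definition lower_jframe_bound h q F J M : set R := [set a | forall f, M f ->
  ((a * qform q f)%:E <= \esum_(i in J) (sqmod (h f (F i)))%:E)%E].
Definition upper_jframe_bound h q F J M : set R := [set b | forall f, M f ->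
  (\esum_(i in J) (sqmod (h f (F i)))%:E <= (b * qform q f)%:E)%E].

Definition optimal_jframe_bounds h q F J M (a b : R) :=
  [/\ lower_jframe_bound h q F J M a, ubound (lower_jframe_bound h q F J M) a,
      upper_jframe_bound h q F J M b & lbound (upper_jframe_bound h q F J M) b].

(* No optimal constants exist for a sign whose M is the zero space. *)
Definition jframe_bounds_plus h Hp Hm F (a b : R) :=
  optimal_jframe_bounds h h F (Iplus h F) (Mplus h Hp Hm F) a b.
Definition jframe_bounds_minus h Hp Hm F (a b : R) :=
  optimal_jframe_bounds h (oppform h) F (Iminus h F) (Mminus h Hp Hm F) a b.

End Frames.

(* S = [B11, B12; B21, B22] with respect to V = M1 + M2, acting on columns. *)
Definition block_representation (S : V -> V) (M1 M2 : set V)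
    (B11 B12 B21 B22 : V -> V) := forall x y, M1 x -> M2 y ->
  S (x + y) = (B11 x + B12 y) + (B21 x + B22 y).

End Krein.

(* Main.v *)
Require Import Defs.
From mathcomp Require Import all_boot all_order all_algebra.
From mathcomp Require Import finmap.
From mathcomp Require Import all_classical all_reals all_analysis.
From mathcomp Require Import summability complex.
From mathcomp Require Import ring lra.

(** Write [S = S_+ - S_-], where [S_± f] is the sum over [I_±] of
    [[f, f_i] f_i]; the range of [S_±] lies in [M_±].  The two halves of the
    theorem are the same argument with the signs exchanged; here is the
    negative one.  Put [E = D + K^* A K].

    The block matrix of [S] is made so that for [y] in [M_-] it sends the vector
    [g = K y + y] to [(A K y - A K y) + (K^* A K y + D y) = E y], which lies in
    [M_-].  Hence [S_+ g = E y + S_- g] lies in both [M_+] and [M_-].  The form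
    is positive definite on the first and negative definite on the second, so
    [S_+ g = 0] and [E y = - S_- g].  Moreover [K y] is [[.,.]]-orthogonal to
    [M_-], so [S_-] does not see it and [E y = - S_- y].  Therefore
      [- [E y, y] = [S_- y, y] = sum over I_- of |[y, f_i]|^2],
    that is, the frame sum over [I_-] is the quadratic form of [E]
    ([esum_frame_coefficients_block]).  The optimal constants comparing this
    quadratic form with [- [y, y]] are by homogeneity the infimum and the
    supremum of the numerical range of [E] ([optimal_bounds_numerical_range]).

    For the positive half the vector is [x + L^* x].

    The one analytic ingredient is that the Krein form is bounded by the Hilbert
    norm of a fundamental decomposition ([krein_form_bounded]): this makes the
    form commute with the unconditionally convergent frame sums
    ([has_sum_form]), and lets uniform positivity pass from the ranges of
    the synthesis operators to the closed spans [M_±]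
    ([uniformly_positive_closure]).  Only real parts of forms matter, so all
    estimates are carried out for real symmetric forms. *)

Set Implicit Arguments.
Unset Strict Implicit.
Unset Printing Implicit Defensive.

Import Order.TTheory GRing.Theory Num.Theory.
Import numFieldNormedType.Exports.

Local Open Scope classical_set_scope.
Local Open Scope ring_scope.

(** * Real symmetric forms *)

Section RealSymmetricForms.
Context {R : realType} {V : lmodType R[i]}.
Implicit Types (B N : V -> V -> R) (M : set V).

(** The space is complex but the form is real-valued: bilinearity is over the
    real scalars only, as holds for the real part of a Hermitian form. *)
Definition real_symmetric B :=
  (forall (a : R) x y z, B (a%:C%C *: x + y) z = a * B x z + B y z) /\
  (forall x y, B x y = B y x).

Lemma real_symmetric0l B x : real_symmetric B -> B 0 x = 0.
Proof.
move=> [lin _]; have := lin 1 0 0 x.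
by rewrite scaler0 addr0; lra.
Qed.

Lemma real_symmetricZl B (a : R) x y : real_symmetric B ->
  B (a%:C%C *: x) y = a * B x y.
Proof.
by move=> symB; rewrite -[_ *: x]addr0 symB.1 real_symmetric0l// addr0.
Qed.

Lemma real_symmetric_comb B (s t : R) x y : real_symmetric B ->
  B (s%:C%C *: x + t%:C%C *: y) (s%:C%C *: x + t%:C%C *: y) =
  s ^+ 2 * B x x + 2 * s * t * B x y + t ^+ 2 * B y y.
Proof.
move=> symB; have [lin sym] := symB.
have linr z : B z (s%:C%C *: x + t%:C%C *: y) = s * B z x + t * B z y.
  by rewrite sym lin real_symmetricZl// (sym x) (sym y).
rewrite linr sym linr (sym (_ + _) y) linr (sym y x).
ring.
Qed.

Lemma real_symmetricZ B (s : R) x : real_symmetric B ->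
  B (s%:C%C *: x) (s%:C%C *: x) = s ^+ 2 * B x x.
Proof.
move=> symB; have := real_symmetric_comb s 0 x x symB.
by rewrite scale0r addr0 => ->; ring.
Qed.

Lemma real_symmetricB B x y : real_symmetric B ->
  B (x - y) (x - y) = B x x - 2 * B x y + B y y.
Proof.
move=> symB; have := real_symmetric_comb 1 (- 1) x y symB.
have -> : ((- 1 : R)%:C%C) = -1 :> R[i] by rewrite rmorphN rmorph1.
rewrite rmorph1 scale1r scaleN1r => ->.
ring.
Qed.

(** [B] may be degenerate: where [B y y] vanishes, [B (s x - t y) (s x - t y)]
    is nonnegative and affine in [t], hence constant in [t]. *)
Lemma cauchy_schwarz B x y : real_symmetric B -> (forall z, 0 <= B z z) ->
  B x y ^+ 2 <= B x x * B y y.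
Proof.
move=> symB B_ge0; set a := B x x; set b := B x y; set c := B y y.
have comb s t : 0 <= s ^+ 2 * a + 2 * s * t * b + t ^+ 2 * c.
  by rewrite -real_symmetric_comb.
have a_ge0 : 0 <= a by exact: B_ge0.
have : 0 <= c by exact: B_ge0.
rewrite le_eqVlt => /orP[/eqP c0|c_gt0].
  have := comb b (- (a + 1)); rewrite -c0 mulr0 addr0 => H.
  have : b ^+ 2 * (a + 2) <= 0 by nra.
  by rewrite pmulr_lle0 ?mulr0//; lra.
have := comb c (- b) => H.
have : 0 <= c * (a * c - b ^+ 2) by nra.
by rewrite pmulr_rge0// subr_ge0.
Qed.

(** [hclosure] stated with squared norms, which avoids square roots. *)
Definition form_closure N M : set V :=
  [set x | forall e : R, 0 < e -> exists2 y, M y & N (x - y) (x - y) < e].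

(** By the parallelogram law, [N (s d + t d')] is at most
    [2 s^2 N d + 2 t^2 N d'], whence the constant in the proof. *)
Lemma form_closure_comb N M (s t : R) x y : real_symmetric N ->
  (forall z, 0 <= N z z) ->
  (forall x' y', M x' -> M y' -> M (s%:C%C *: x' + t%:C%C *: y')) ->
  form_closure N M x -> form_closure N M y ->
  form_closure N M (s%:C%C *: x + t%:C%C *: y).
Proof.
move=> symN N_ge0 combM clx cly e e_gt0.
set c := 2 * (s ^+ 2 + t ^+ 2) + 1.
have c_gt0 : 0 < c by rewrite /c; nra.
have [x' Mx' xlt] := clx _ (divr_gt0 e_gt0 c_gt0).
have [y' My' ylt] := cly _ (divr_gt0 e_gt0 c_gt0).
exists (s%:C%C *: x' + t%:C%C *: y'); first exact: combM.
rewrite opprD addrACA -!scalerBr.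
set d := x - x' in xlt *; set d' := y - y' in ylt *; clearbody d d'.
have := N_ge0 (s%:C%C *: d + (- t)%:C%C *: d').
rewrite !real_symmetric_comb// => par.
have ecE : e = (e / c) * c by rewrite divfK ?gt_eqF.
set r := e / c in xlt ylt ecE; rewrite ecE /c; clearbody r.
have h1 : s ^+ 2 * N d d <= s ^+ 2 * r by rewrite ler_wpM2l ?sqr_ge0 ?ltW.
have h2 : t ^+ 2 * N d' d' <= t ^+ 2 * r by rewrite ler_wpM2l ?sqr_ge0 ?ltW.
have r_gt0 : 0 < r by rewrite (le_lt_trans (N_ge0 d)).
nra.
Qed.

(** Continuity of [B - a N]: with [G = B - a N] and [y = x - d] in [M] near [x],
    [G x x = G y y + 2 G x d - G d d], where [G y y] is nonnegative and the other
    terms are of order [e] by the Cauchy-Schwarz inequality. *)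
Lemma uniformly_positive_closure N B (a : R) M :
  real_symmetric N -> (forall x, 0 <= N x x) -> real_symmetric B ->
  (forall x y, B x y ^+ 2 <= N x x * N y y) -> 0 <= a ->
  (forall x, M x -> a * N x x <= B x x) ->
  forall x, form_closure N M x -> a * N x x <= B x x.
Proof.
move=> symN N_ge0 symB B_le a_ge0 posM x clx.
set n := Num.sqrt (N x x).
have n_ge0 : 0 <= n by exact: sqrtr_ge0.
have n2 : N x x = n ^+ 2 by rewrite sqr_sqrtr.
suff H (e : R) : 0 < e -> e <= 1 ->
    a * N x x <= B x x + (2 * (1 + a) * n + 1) * e.
  apply/ler_addgt0Pr => e e_gt0.
  set C := 2 * (1 + a) * n + 1.
  have C_gt0 : 0 < C by rewrite /C; nra.
  have m_gt0 : 0 < Num.min 1 (e / C) by rewrite lt_min ltr01 divr_gt0.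
  apply: (le_trans (H _ m_gt0 _)); first by rewrite ge_min lexx.
  by rewrite lerD2l mulrC -ler_pdivlMr// ge_min lexx orbT.
move=> e_gt0 e_le1.
have [|y My ylt] := clx (e ^+ 2); first by rewrite exprn_gt0.
set d := x - y in ylt.
have yE : y = x - d by rewrite /d subKr.
clearbody d.
have := posM _ My; rewrite yE !real_symmetricB//.
have small (u : R) : u ^+ 2 <= N x x * N d d -> `|u| <= n * e.
  move=> ule; rewrite -(ler_pXn2r (n:=2))// ?nnegrE ?mulr_ge0 ?(ltW e_gt0)//.
  rewrite -normrX ger0_norm ?sqr_ge0// exprMn.
  apply: (le_trans ule); rewrite n2.
  by rewrite ler_wpM2l ?sqr_ge0// ltW.
have := small _ (B_le x d); have := small _ (cauchy_schwarz x d symN N_ge0).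
have : `|B d d| <= N d d.
  by rewrite -(ler_pXn2r (n:=2))// ?nnegrE// -normrX ger0_norm ?sqr_ge0//.
rewrite !ler_norml => /andP[_ Bdd] /andP[_ Nxd2] /andP[Bxd1 _].
have Ndd := N_ge0 d.
move=> H.
have h1 : a * N x d <= a * (n * e) by rewrite ler_wpM2l.
have h3 : 0 <= a * N d d by rewrite mulr_ge0.
have h4 : e ^+ 2 <= e by nra.
nra.
Qed.

End RealSymmetricForms.

(** * Krein forms and the Hilbert norm of a fundamental decomposition *)

Section HermitianForms.
Context {R : realType} {V : lmodType R[i]}.
Implicit Types (h : krein_form (V := V)) (q : V -> V -> R[i]).

Definition re_form q (x y : V) : R := complex.Re (q x y).

Lemma krein_formC h x y : h x y = (h y x)^*.
Proof. by have := hermC h x y; rewrite expr0 mul1r. Qed.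

Lemma Re_conj (z : R[i]) : complex.Re (z^*) = complex.Re z.
Proof. by case: z. Qed.

Lemma Re_scale (a : R) (z : R[i]) : complex.Re (a%:C%C * z) = a * complex.Re z.
Proof. by case: z => x y /=; rewrite mul0r subr0. Qed.

Lemma re_form_symmetric h : real_symmetric (re_form h).
Proof.
split=> [a x y z|x y]; rewrite /re_form.
  by rewrite linearPl raddfD /= Re_scale.
by rewrite krein_formC Re_conj.
Qed.

Lemma re_form_opp_symmetric h : real_symmetric (re_form (oppform h)).
Proof.
have [lin sym] := re_form_symmetric h.
have opp x y : re_form (oppform h) x y = - re_form h x y.
  by rewrite /re_form raddfN.
split=> [a x y z|x y]; rewrite !opp; first by rewrite lin; ring.
by rewrite sym.
Qed.

End HermitianForms.

Section Subspaces.
Context {R : realType} {V : lmodType R[i]}.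
Implicit Types (M : set V).

Lemma subspaceD M x y : Defs.subspace M -> M x -> M y -> M (x + y).
Proof. by move=> [_ M1] Mx My; rewrite -[x]scale1r; exact: M1. Qed.

Lemma subspaceZ M (a : R[i]) x : Defs.subspace M -> M x -> M (a *: x).
Proof. by move=> [M0 M1] Mx; rewrite -[_ *: _]addr0; exact: M1. Qed.

Lemma subspaceN M x : Defs.subspace M -> M x -> M (- x).
Proof. by move=> sM Mx; rewrite -scaleN1r; exact: subspaceZ. Qed.

Lemma subspace_sum (J : Type) (r : seq J) (P : pred J) (g : J -> V) M :
  Defs.subspace M -> (forall i, P i -> M (g i)) -> M (\sum_(i <- r | P i) g i).
Proof.
move=> sM gM; elim/big_ind : _ => //; first by case: sM.
by move=> x y; exact: subspaceD.
Qed.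

End Subspaces.

Section FundamentalDecomposition.
Context {R : realType} {V : lmodType R[i]}.
Context {h : krein_form (V := V)} {Hp Hm : set V}.
Hypothesis fd : fundamental_decomposition h Hp Hm.

Lemma pos_part_neg_part x : Hp (pos_part Hp Hm x) /\ Hm (neg_part Hp Hm x).
Proof.
case: fd => _ _ _ dec _; have [y [z [Hy Hz xE]]] := dec x.
rewrite /neg_part /pos_part; case: xgetP => [w _ []//|/(_ y) []].
by rewrite /= xE addrC addKr.
Qed.

Lemma pos_part_uniq x y : Hp y -> Hm (x - y) -> pos_part Hp Hm x = y.
Proof.
case: fd => -[sp _ _] [sm _ _] _ _ triv Hy Hxy.
have [Px Nx] := pos_part_neg_part x.
apply/eqP; rewrite -subr_eq0; apply/eqP/triv.
  by apply: subspaceD => //; exact: subspaceN.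
suff -> : pos_part Hp Hm x - y = (x - y) - neg_part Hp Hm x.
  by apply: subspaceD => //; exact: subspaceN.
by rewrite /neg_part opprB [RHS]addrC addrA subrK.
Qed.

Lemma pos_part_linear (a : R[i]) x y :
  pos_part Hp Hm (a *: x + y) = a *: pos_part Hp Hm x + pos_part Hp Hm y.
Proof.
case: fd => -[[_ sp] _ _] [[_ sm] _ _] _ _ _.
have [Px Nx] := pos_part_neg_part x; have [Py Ny] := pos_part_neg_part y.
apply: pos_part_uniq; first exact: sp.
suff -> : a *: x + y - (a *: pos_part Hp Hm x + pos_part Hp Hm y) =
   a *: neg_part Hp Hm x + neg_part Hp Hm y by exact: sm.
by rewrite /neg_part scalerBr opprD addrACA.
Qed.

Lemma neg_part_linear (a : R[i]) x y :
  neg_part Hp Hm (a *: x + y) = a *: neg_part Hp Hm x + neg_part Hp Hm y.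
Proof. by rewrite /neg_part pos_part_linear scalerBr opprD addrACA. Qed.

Lemma krein_form_split xp xm yp ym : Hp xp -> Hm xm -> Hp yp -> Hm ym ->
  h (xp + xm) (yp + ym) = h xp yp + h xm ym.
Proof.
case: fd => _ _ orth _ _ Hxp Hxm Hyp Hym.
rewrite linearDl /= !linearDr /= (orth _ _ Hxp Hym).
by rewrite [h xm yp]krein_formC (orth _ _ Hyp Hxm) rmorph0 addr0 add0r.
Qed.

Let N := re_form (hip h Hp Hm).

Lemma hip_symmetric : real_symmetric N.
Proof.
have [lin sym] := re_form_symmetric h.
have NE x y : N x y = re_form h (pos_part Hp Hm x) (pos_part Hp Hm y) -
                      re_form h (neg_part Hp Hm x) (neg_part Hp Hm y).
  by rewrite /N /re_form /hip raddfB.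
split=> [a x y z|x y]; rewrite !NE.
  by rewrite pos_part_linear neg_part_linear !lin; ring.
by rewrite sym [X in _ - X]sym.
Qed.

Lemma hip_gt0 x : x != 0 -> 0 < N x x.
Proof.
have [Px Nx] := pos_part_neg_part x.
case: fd => -[_ pp _] [_ pm _] _ _ _.
have NE : N x x = qform h (pos_part Hp Hm x) +
                  qform (oppform h) (neg_part Hp Hm x).
  by rewrite /N /re_form /qform /hip /oppform raddfB raddfN.
have [p0|p0] := eqVneq (pos_part Hp Hm x) 0;
  have [n0|n0] := eqVneq (neg_part Hp Hm x) 0; move=> x0.
- by move: x0 n0; rewrite /neg_part p0 subr0 => /eqP.
- by rewrite NE p0 {1}/qform linear0l add0r; exact: pm.
- by rewrite NE n0 {2}/qform /oppform linear0l oppr0 addr0; exact: pp.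
- by rewrite NE addr_gt0; [|exact: pp|exact: pm].
Qed.

Lemma hip_ge0 x : 0 <= N x x.
Proof.
have [->|/hip_gt0/ltW//] := eqVneq x 0.
by rewrite (real_symmetric0l _ hip_symmetric).
Qed.

(** The form is the Hilbert inner product twisted by the fundamental symmetry
    [y_+ + y_- |-> y_+ - y_-], which preserves the norm; the bound is then the
    Cauchy-Schwarz inequality. *)
Lemma krein_form_bounded x y : re_form h x y ^+ 2 <= N x x * N y y.
Proof.
pose y' := pos_part Hp Hm y - neg_part Hp Hm y.
have [Px Nx] := pos_part_neg_part x; have [Py Ny] := pos_part_neg_part y.
have sm : Defs.subspace Hm by case: fd => _ [].
have p' : pos_part Hp Hm y' = pos_part Hp Hm y.
  apply: pos_part_uniq => //; rewrite /y' addrAC subrr add0r.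
  exact: subspaceN.
have n' : neg_part Hp Hm y' = - neg_part Hp Hm y.
  by rewrite {1}/neg_part p' /y' addrAC subrr add0r.
have -> : N y y = N y' y'.
  by rewrite /N /re_form /hip p' n' linearNl linearNr opprK.
suff -> : re_form h x y = N x y'.
  exact: (cauchy_schwarz _ _ hip_symmetric hip_ge0).
rewrite /N /re_form /hip p' n' linearNr opprK.
have split z : z = pos_part Hp Hm z + neg_part Hp Hm z.
  by rewrite /neg_part addrC subrK.
by rewrite {1}[x]split {1}[y]split krein_form_split.
Qed.

Lemma krein_oppform_bounded x y : re_form (oppform h) x y ^+ 2 <= N x x * N y y.
Proof.
by rewrite /re_form raddfN sqrrN; exact: krein_form_bounded.
Qed.

End FundamentalDecomposition.

Section HilbertNorm.
Context {R : realType} {V : lmodType R[i]}.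
Implicit Types (ip : V -> V -> R[i]) (M : set V).

Lemma hnorm_lt ip x (e : R) : 0 < e ->
  (hnorm ip x < e) = (re_form ip x x < e ^+ 2).
Proof.
move=> e0; rewrite /hnorm -[RHS](@ltr_sqrt _ _ (e ^+ 2)) ?exprn_gt0//.
by rewrite sqrtr_sqr gtr0_norm.
Qed.

Lemma hclosureE ip M : hclosure ip M = form_closure (re_form ip) M.
Proof.
apply/seteqP; split => x clx e e0.
  have se : 0 < Num.sqrt e by rewrite sqrtr_gt0.
  have [y My] := clx _ se; rewrite hnorm_lt// sqr_sqrtr ?ltW//.
  by exists y.
have [|y My ylt] := clx (e ^+ 2); first by rewrite exprn_gt0.
by exists y; rewrite // hnorm_lt.
Qed.

Lemma has_sumP ip (I : choiceType) (J : set I) (g : I -> V) x :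
  has_sum ip J g x <-> forall e : R, 0 < e -> exists A : {fset I},
    forall B : {fset I}, (A `<=` B)%fset ->
      let d := x - \sum_(i <- B | i \in J) g i in re_form ip d d < e.
Proof.
have filterT : Filter (@totally I) by exact: totally_filter.
split=> [/cvgr0Pnorm_lt H e e0|H].
  have se : 0 < Num.sqrt e by rewrite sqrtr_gt0.
  have [A _ AB] := H _ se; exists A => B /AB /=.
  by rewrite ger0_norm ?sqrtr_ge0// hnorm_lt// sqr_sqrtr ?ltW.
apply: (proj2 (cvgr0Pnorm_lt _)) => e e0.
have [|A AB] := H (e ^+ 2); first by rewrite exprn_gt0.
by exists A => // B /AB; rewrite /= ger0_norm ?sqrtr_ge0// hnorm_lt.
Qed.

End HilbertNorm.

(** * Sums of nonnegative families *)

(** For nonnegative families the limit along the net of finite subsets is the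
    supremum of the finite partial sums, because these increase. *)
Lemma esum_net_limit (R : realType) (I : choiceType) (J : set I) (a : I -> R)
    (s : R) : (forall i, 0 <= a i) ->
  (forall e : R, 0 < e -> exists A : {fset I}, forall B : {fset I},
     (A `<=` B)%fset -> `|s - \sum_(i <- B | i \in J) a i| < e) ->
  \esum_(i in J) (a i)%:E = s%:E.
Proof.
move=> a_ge0 lim; apply/eqP; rewrite eq_le; apply/andP; split; last first.
  apply/lee_addgt0Pr => e e_gt0; have [A AB] := lim _ e_gt0.
  have := AB A (fsubset_refl A); rewrite ltr_distl => /andP[_ sle].
  rewrite -leeBlDr//; apply: esum_ge; exists ([set` A] `&` J).
    by split; [exact: finite_setIl|exact: subIsetr].
  rewrite fsbig_mkcondr -fsbig_seq ?fset_uniq// -big_mkcond sumEFin.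
  by rewrite -EFinB lee_fin lerBlDr ltW.
apply: ge_ereal_sup => _ [X [finX XJ] <-].
apply/lee_addgt0Pr => e e_gt0; have [A AB] := lim _ e_gt0.
have := AB _ (fsubsetUl A (fset_set X)); rewrite ltr_distlC => /andP[_ sle].
rewrite fsbig_finite//=.
have -> : \sum_(i <- fset_set X) (a i)%:E =
          \sum_(i <- fset_set X | i \in J) (a i)%:E.
  rewrite big_seq [RHS]big_seq_cond; apply: eq_bigl => i.
  have [iX|//] := boolP (i \in fset_set X).
  by symmetry; apply/mem_set/XJ; move: iX; rewrite in_fset_set// inE.
apply: (@le_trans _ _ (\sum_(i <- A `|` fset_set X | i \in J) (a i)%:E)%fset).
  apply: lee_sum_nneg_subfset => [i iX|i _ _]; last by rewrite lee_fin.
  by rewrite in_fsetE iX orbT.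
by rewrite sumEFin -EFinD lee_fin ltW.
Qed.

(** * Optimal bounds and numerical ranges *)

Section NumericalRangeBounds.
Context {R : realType} {V : lmodType R[i]}.
Implicit Types (q : V -> V -> R[i]) (M : set V).

Lemma bounded_operator_re_formZ q M (E : V -> V) (r : R) (x : V) :
  (forall (s : R) y, M y -> M (s%:C%C *: y)) ->
  real_symmetric (re_form q) -> bounded_operator M q M q E -> M x ->
  re_form q (E (r%:C%C *: x)) (r%:C%C *: x) = r ^+ 2 * re_form q (E x) x.
Proof.
move=> Mscale symq [_ Elin _] Mx.
have M0 : M 0 by have := Mscale 0 x Mx; rewrite scale0r.
have E0 : E 0 = 0.
  have := Elin 1 0 0 M0 M0; rewrite !scale1r addr0 => /eqP.
  by rewrite -subr_eq0 opprD addrA subrr sub0r oppr_eq0 => /eqP.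
have -> : E (r%:C%C *: x) = r%:C%C *: E x.
  by rewrite -[_ *: x]addr0 Elin// E0 addr0.
by rewrite real_symmetricZl// symq.2 real_symmetricZl// symq.2 mulrA expr2.
Qed.

Lemma qform_normalize q M (E : V -> V) y :
  real_symmetric (re_form q) ->
  (forall (r : R) x, M x -> M (r%:C%C *: x)) ->
  bounded_operator M q M q E -> M y -> 0 < qform q y ->
  exists g, [/\ M g, hnorm q g = 1 &
    re_form q (E y) y = qform q y * re_form q (E g) g].
Proof.
move=> symq Mscale bE My y_gt0; set n := hnorm q y.
have n_gt0 : 0 < n by rewrite sqrtr_gt0.
have n2 : qform q y = n ^+ 2 by rewrite sqr_sqrtr// ltW.
exists ((n^-1)%:C%C *: y); split; first exact: Mscale.
  have <- : n * n^-1 = 1 by rewrite mulfV ?gt_eqF.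
  rewrite /hnorm; have -> : qform q ((n^-1)%:C%C *: y) = n ^- 2 * qform q y.
    by rewrite -exprVn; exact: (@real_symmetricZ _ _ (re_form q)).
  by rewrite n2 mulVf ?sqrtr1 ?mulfV ?gt_eqF ?exprn_gt0.
rewrite (bounded_operator_re_formZ _ Mscale symq bE)// n2 exprVn.
by rewrite mulrA mulfV ?mul1r ?gt_eqF ?exprn_gt0.
Qed.

(** Both sides of the frame inequalities are homogeneous of degree two, so a
    number is a lower (upper) bound if and only if it bounds the numerical range
    from below (above).  When [M] is zero every number is a bound, no optimal
    one exists, and the statement is vacuous. *)
Lemma optimal_bounds_numerical_range (h : krein_form (V := V)) q (I : choiceType)
    (F : I -> V) (J : set I) (M : set V) (E : V -> V) (a b : R) :
  real_symmetric (re_form q) ->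
  (forall x, M x -> x != 0 -> 0 < qform q x) ->
  (forall (r : R) x, M x -> M (r%:C%C *: x)) ->
  bounded_operator M q M q E ->
  (forall y, M y ->
    \esum_(i in J) (sqmod (h y (F i)))%:E = (re_form q (E y) y)%:E) ->
  optimal_jframe_bounds h q F J M a b ->
  a%:E = inf_range M q E /\ b%:E = sup_range M q E.
Proof.
move=> symq posq Mscale bE sumE [lowa maxa uppb minb].
have form0 : re_form q (E 0) 0 = 0 /\ qform q 0 = 0.
  by rewrite symq.2 real_symmetric0l// [qform q 0](real_symmetric0l _ symq).
have lowE r : (forall g, M g -> hnorm q g = 1 -> r <= re_form q (E g) g) ->
    lower_jframe_bound h q F J M r.
  move=> rle y My; rewrite sumE// lee_fin.
  have [y0|y0] := eqVneq y 0.
    by rewrite y0 form0.1 form0.2 mulr0.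
  have [g [Mg g1 ->]] := qform_normalize symq Mscale bE My (posq _ My y0).
  by rewrite mulrC ler_pM2l ?posq// rle.
have uppE r : (forall g, M g -> hnorm q g = 1 -> re_form q (E g) g <= r) ->
    upper_jframe_bound h q F J M r.
  move=> rle y My; rewrite sumE// lee_fin.
  have [y0|y0] := eqVneq y 0.
    by rewrite y0 form0.1 form0.2 mulr0.
  have [g [Mg g1 ->]] := qform_normalize symq Mscale bE My (posq _ My y0).
  by rewrite mulrC ler_pM2r ?posq// rle.
have unit g : hnorm q g = 1 -> qform q g = 1.
  move=> g1; have g_gt0 : 0 < qform q g by rewrite -sqrtr_gt0 -/(hnorm q g) g1.
  by rewrite -[LHS]sqr_sqrtr ?ltW// -/(hnorm q g) g1 expr1n.
split; apply/eqP; rewrite eq_le; apply/andP; split.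
- apply: le_ereal_inf_tmp => _ [_ [g [Mg g1] <-] <-].
  by have := lowa g Mg; rewrite sumE// unit// mulr1.
- apply/lee_addgt0Pr => e e_gt0; rewrite leNgt; apply/negP => lt_inf.
  suff : a + e <= a by rewrite gerDl leNgt e_gt0.
  apply: maxa; apply: lowE => g Mg g1; rewrite -lee_fin EFinD.
  apply: (le_trans (ltW lt_inf)); apply: ge_ereal_inf.
  by exists (re_form q (E g) g)%:E => //; exists (q (E g) g) => //; exists g.
- apply/lee_subgt0Pr => e e_gt0; rewrite leNgt; apply/negP => lt_sup.
  suff : b <= b - e by rewrite lerBrDr gerDl leNgt e_gt0.
  apply: minb; apply: uppE => g Mg g1; rewrite -lee_fin EFinB.
  apply: (le_trans _ (ltW lt_sup)); apply: ereal_sup_ubound.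
  by exists (q (E g) g) => //; exists g.
- apply: ge_ereal_sup => _ [_ [g [Mg g1] <-] <-].
  by have := uppb g Mg; rewrite sumE// unit// mulr1.
Qed.

End NumericalRangeBounds.

(** * Frame sums in a Krein space *)

Section JFrames.
Context {R : realType} {V : lmodType R[i]}.
Context {h : krein_form (V := V)} {Hp Hm : set V}.
Hypothesis fd : fundamental_decomposition h Hp Hm.
Context {I : choiceType} (F : I -> V).
Implicit Types (J : set I) (M : set V).

Let ip := hip h Hp Hm.
Let N := re_form ip.
Let N_sym : real_symmetric N := hip_symmetric fd.
Let N_ge0 : forall x, 0 <= N x x := hip_ge0 fd.

(** [Mplus] and [Mminus] are the instances [Iplus h F] and [Iminus h F]. *)
Definition closed_span J : set V := hclosure ip (linear_span (F @` J)).

Lemma linear_span_subspace (G : set V) : Defs.subspace (linear_span G).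
Proof.
split=> [X [[]]//|a x y Gx Gy X HX].
by case: (HX) => -[_ lin] _; apply: lin; [exact: Gx|exact: Gy].
Qed.

Lemma closed_span_comb J (s t : R) x y :
  closed_span J x -> closed_span J y ->
  closed_span J (s%:C%C *: x + t%:C%C *: y).
Proof.
rewrite /closed_span hclosureE => clx cly.
apply: form_closure_comb => // u v Gu Gv.
have sG := linear_span_subspace (F @` J).
by apply: (subspaceD sG); exact: (subspaceZ _ sG).
Qed.

Lemma closed_spanZ J (s : R) x : closed_span J x -> closed_span J (s%:C%C *: x).
Proof.
by move=> Mx; have := closed_span_comb s 0 Mx Mx; rewrite scale0r addr0.
Qed.

Lemma closed_spanN J x : closed_span J x -> closed_span J (- x).
Proof. by move=> /(closed_spanZ (- 1)); rewrite rmorphN rmorph1 scaleN1r. Qed.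

Lemma closed_spanB J x y :
  closed_span J x -> closed_span J y -> closed_span J (x - y).
Proof.
move=> Mx My; have := closed_span_comb 1 (- 1) Mx My.
by rewrite rmorphN rmorph1 scale1r scaleN1r.
Qed.

Lemma sub_hclosure M : M `<=` hclosure ip M.
Proof.
move=> x Mx e e_gt0; exists x => //; rewrite subrr hnorm_lt//.
by rewrite [X in X < _](real_symmetric0l _ N_sym) exprn_gt0.
Qed.

Lemma closed_span_mem J i : J i -> closed_span J (F i).
Proof. by move=> Ji; apply: sub_hclosure; apply: sub_gen_smallest; exists i. Qed.

Lemma has_sum_closed_span J (c : I -> R[i]) v :
  has_sum ip J (fun i => c i *: F i) v -> closed_span J v.
Proof.
rewrite /closed_span hclosureE => /has_sumP H e e_gt0.
have [A AB] := H _ e_gt0; exists (\sum_(i <- A | i \in J) c i *: F i).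
  apply: subspace_sum => [|i]; first exact: linear_span_subspace.
  rewrite inE => Ji; apply: (subspaceZ _ (linear_span_subspace _)).
  by apply: sub_gen_smallest; exists i.
exact: AB.
Qed.

(** [F i] is the image of the [i]-th unit vector of [ell2]. *)
Lemma synthesis_range_mem J i : J i -> synthesis_range ip F J (F i).
Proof.
move=> Ji; pose c j : R[i] := (j == i)%:R.
exists c.
  rewrite /ell2 [X in (X < _)%E](_ : _ = \esum_(j in [set i]) (1 : R)%:E).
    by rewrite esum_set1 ?ltry// lee_fin.
  rewrite -[in RHS](setTI [set i]) esum_mkcondr; apply: eq_esum => j _.
  rewrite /c; have [->|ji] := eqVneq j i.
    by rewrite mem_set//= /sqmod normr1 /= expr1n.
  rewrite memNset; last by move/eqP; rewrite (negbTE ji).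
  by rewrite /sqmod normr0 /= expr0n.
apply/has_sumP => e e_gt0; exists [fset i]%fset => B iB.
suff -> : \sum_(j <- B | j \in J) c j *: F j = F i.
  by rewrite /= subrr [X in X < _](real_symmetric0l _ N_sym).
rewrite big_mkcond (bigD1_seq i) ?fset_uniq//=; last first.
  by rewrite -fsub1set.
rewrite mem_set// /c eqxx scale1r big1 ?addr0// => j /negbTE ->.
by rewrite scale0r if_same.
Qed.

Lemma closed_span_uniformly_positive J (q : V -> V -> R[i]) :
  real_symmetric (re_form q) ->
  (forall x y, re_form q x y ^+ 2 <= N x x * N y y) ->
  uniformly_positive_subspace ip q (synthesis_range ip F J) ->
  exists2 a : R, 0 < a & forall x, closed_span J x -> a * N x x <= qform q x.
Proof.
move=> symq bndq [sM [a a_gt0 posM]]; exists a => //.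
rewrite /closed_span hclosureE.
apply: (@uniformly_positive_closure _ _ N (re_form q) a) => //; first exact: ltW.
move=> x spx; rewrite -[N x x]sqr_sqrtr//; apply: posM.
by apply: (smallest_sub _ _ spx) => // _ [i Ji <-]; exact: synthesis_range_mem.
Qed.

(** The form is continuous in its first argument, so it may be applied to a
    convergent sum term by term. *)
Lemma has_sum_form J (g : I -> V) u y : has_sum ip J g u ->
  forall e : R, 0 < e -> exists A : {fset I}, forall B : {fset I},
    (A `<=` B)%fset ->
    `|re_form h u y - \sum_(i <- B | i \in J) re_form h (g i) y| < e.
Proof.
move=> /has_sumP H e e_gt0.
have c_gt0 : 0 < N y y + 1 by rewrite ltr_wpDl.
(* adding 1 keeps the denominator nonzero when [N y y] vanishes *)
have [|A AB] := H (e ^+ 2 / (N y y + 1)).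
  by rewrite divr_gt0 ?exprn_gt0.
exists A => B /AB /=; set d := u - _ => dlt.
have -> : re_form h u y - \sum_(i <- B | i \in J) re_form h (g i) y =
          re_form h d y.
  by rewrite /re_form /d linearBl /= raddfB /= linear_sumlz [in RHS]raddf_sum.
rewrite -(ltr_pXn2r (n:=2))// ?nnegrE ?(ltW e_gt0)//.
rewrite -normrX ger0_norm ?sqr_ge0// (le_lt_trans (krein_form_bounded fd d y))//.
move: dlt; rewrite ltr_pdivlMr//; apply: le_lt_trans.
by rewrite ler_wpM2l ?hip_ge0// lerDl.
Qed.

(** With [u] the partial frame operator of [J] at [g], this is
    [[u, y] = sum of [y, f_i] [f_i, y]]; changing [g] by a vector orthogonal to
    the [f_i] does not change [u], hence the hypothesis linking [g] and [y]. *)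
Lemma esum_frame_coefficients J (g u y : V) :
  has_sum ip J (fun i => h g (F i) *: F i) u ->
  (forall i, J i -> h g (F i) = h y (F i)) ->
  \esum_(i in J) (sqmod (h y (F i)))%:E = (re_form h u y)%:E.
Proof.
move=> sumu gy; apply: esum_net_limit => [i|e e_gt0]; first exact: sqr_ge0.
have [A AB] := has_sum_form y sumu e_gt0; exists A => B /AB.
congr (`|_ - _| < e); apply: eq_bigr => i; rewrite inE => Ji.
rewrite /re_form linearZl_LR /= gy// [h (F i) y]krein_formC.
rewrite /sqmod -normCK normc_def -rmorphXn /=.
by rewrite expr2.
Qed.

(** Here [u - v] is the value at [g] of the frame operator, up to sign.  That it
    lies in the first span forces [v] into both spans, so [v] vanishes. *)
Lemma esum_frame_coefficients_block J1 J2 (g y u v : V) :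
  (forall x, closed_span J1 x -> closed_span J2 x -> x = 0) ->
  has_sum ip J1 (fun i => h g (F i) *: F i) u ->
  has_sum ip J2 (fun i => h g (F i) *: F i) v ->
  closed_span J1 (u - v) -> orthocompl h (closed_span J1) (g - y) ->
  \esum_(i in J1) (sqmod (h y (F i)))%:E = (re_form h (u - v) y)%:E.
Proof.
move=> triv sumu sumv Muv orth.
have v0 : v = 0.
  apply: triv; last exact: has_sum_closed_span sumv.
  rewrite -(subKr u v); apply: closed_spanB => //.
  exact: has_sum_closed_span sumu.
rewrite v0 subr0; apply: (esum_frame_coefficients sumu) => i Ji.
have := orth _ (closed_span_mem Ji); rewrite linearBl => /eqP.
by rewrite subr_eq0 => /eqP.
Qed.

End JFrames.

Theorem proposition4p1 (R : realType) (V : lmodType R[i])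
    (h : krein_form (V := V)) (Hp Hm : set V)
    (krein : fundamental_decomposition h Hp Hm)
    (I : choiceType) (F : I -> V) (frameF : jframe h Hp Hm F)
    (S : V -> V) (opS : jframe_operator h Hp Hm F S) :
  let Mp := Mplus h Hp Hm F in
  let Mm := Mminus h Hp Hm F in
  let Mpo := orthocompl h Mp in
  let Mmo := orthocompl h Mm in
  let hn := oppform h in
  (forall am bm : R, 0 < am -> am <= bm -> jframe_bounds_minus h Hp Hm F am bm ->
   forall A K Ks D : V -> V,
     bounded_operator Mm hn Mmo h K ->
     is_adjoint Mm hn Mmo h K Ks ->
     block_representation S Mmo Mm
       A (fun y => - A (K y))
       (fun x => Ks (A x)) D ->
     uniformly_positive_operator Mmo h A ->
     (opnorm Mm hn h K < 1%:E)%E ->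
     selfadjoint Mm hn D ->
     uniformly_positive_operator Mm hn (fun y => D y + Ks (A (K y))) ->
     am%:E = inf_range Mm hn (fun y => D y + Ks (A (K y))) /\
     bm%:E = sup_range Mm hn (fun y => D y + Ks (A (K y)))) /\
  (forall ap bp : R, 0 < ap -> ap <= bp -> jframe_bounds_plus h Hp Hm F ap bp ->
   forall A' L Ls D' : V -> V,
     bounded_operator Mpo hn Mp h L ->
     is_adjoint Mpo hn Mp h L Ls ->
     block_representation S Mp Mpo
       A' (fun y => L (D' y))
       (fun x => - D' (Ls x)) D' ->
     selfadjoint Mp h A' ->
     uniformly_positive_operator Mp h (fun x => A' x + L (D' (Ls x))) ->
     (opnorm Mpo hn h L < 1%:E)%E ->
     uniformly_positive_operator Mpo hn D' ->
     ap%:E = inf_range Mp h (fun x => A' x + L (D' (Ls x))) /\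
     bp%:E = sup_range Mp h (fun x => A' x + L (D' (Ls x)))).
Proof.
move=> Mp Mm Mpo Mmo hn.
have [_ [posP _] [posM _]] := frameF.
have symh := re_form_symmetric h; have symhn := re_form_opp_symmetric h.
have [a a_gt0 aP] := closed_span_uniformly_positive krein symh
  (krein_form_bounded krein) posP.
have [b b_gt0 bM] := closed_span_uniformly_positive krein symhn
  (krein_oppform_bounded krein) posM.
(* [h x x] is at least [a N x x] and at most [- b N x x] *)
have triv x : Mp x -> Mm x -> x = 0.
  move=> /aP xP /bM xM; apply/eqP; apply: contraT => x0.
  have := hip_gt0 krein x0; move: xP xM; rewrite /qform /oppform raddfN /=.
  set n := re_form _ x x; set t := complex.Re _ => xP xM n_gt0.
  have : 0 < a * n by rewrite mulr_gt0.
  have : 0 < b * n by rewrite mulr_gt0.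
  by clear -xP xM; lra.
split=> [am bm _ _ bounds A K Ks D [KM _ _] [KsM _] blockS _ _ _ [[bE _] _ _]
        |ap bp _ _ bounds A' L Ls D' _ [LsM _] blockS _ [[bE _] _ _] _ _].
- have [EM _ _] := bE.
  apply: (optimal_bounds_numerical_range symhn _ _ bE _ bounds)
    => [x Mx x0|r x|y My].
  + by apply: lt_le_trans (bM _ Mx); rewrite mulr_gt0//; exact: hip_gt0.
  + exact: closed_spanZ.
  have [u [v [sumu sumv SE]]] := opS (K y + y).
  (* the first row of the block matrix vanishes on [K y + y] *)
  have SKy : S (K y + y) = D y + Ks (A (K y)).
    by rewrite blockS//; [rewrite subrr add0r addrC|exact: KM].
  have vuE : v - u = - (D y + Ks (A (K y))) by rewrite -SKy SE opprB.
  rewrite (esum_frame_coefficients_block krein (y := y) _ sumv sumu).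
  + by rewrite vuE /re_form /hn /oppform linearNl.
  + by move=> x Mx Px; exact: triv.
  + by rewrite vuE; apply: closed_spanN => //; exact: EM.
  + by rewrite addrK; exact: KM.
- have [EM _ _] := bE.
  apply: (optimal_bounds_numerical_range symh _ _ bE _ bounds)
    => [x Mx x0|r x|x Mx].
  + by apply: lt_le_trans (aP _ Mx); rewrite mulr_gt0//; exact: hip_gt0.
  + exact: closed_spanZ.
  have [u [v [sumu sumv SE]]] := opS (x + Ls x).
  (* the second row of the block matrix vanishes on [x + Ls x] *)
  have Sx : S (x + Ls x) = A' x + L (D' (Ls x)).
    by rewrite blockS//; [rewrite addNr addr0|exact: LsM].
  rewrite (esum_frame_coefficients_block krein (y := x) _ sumu sumv).
  + by rewrite -SE Sx.
  + exact: triv.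
  + by rewrite -SE Sx; exact: EM.
  + by rewrite addrC addKr; exact: LsM.
Qed.
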